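(* For every positive integer $k$, $$G^C_k(q;a,c,d)=(cq;q)_{k+1}\sum_{j=0}^{k+1}\frac{u_j(a,c,c,d)\,q^{\binom{k+1-j}{2}}}{(q;q)_{k+1-j}},$$ where $u_j(a,b,c,d)$ is defined for all $n\ge0$ by $$u_{2n}(a,b,c,d)=(1-b)\sum_{\ell=0}^{n}\frac{(-aq^{2\ell+1};q^2)_{n-\ell}(-dq^{2\ell+1};q^2)_{n-\ell}}{(bq^{2\ell};q^2)_{n-\ell+1}(cq^{2\ell+1};q^2)_{n-\ell}}\frac{q^{2\ell}}{(q;q)_{2\ell}},$$ $$u_{2n+1}(a,b,c,d)=(b-1)\sum_{\ell=0}^{n}\frac{(-aq^{2\ell+2};q^2)_{n-\ell}(-dq^{2\ell+2};q^2)_{n-\ell}}{(bq^{2\ell+1};q^2)_{n-\ell+1}(cq^{2\ell+2};q^2)_{n-\ell}}\frac{q^{2\ell+1}}{(q;q)_{2\ell+1}},$$ and $u_j(a,c,c,d)$ denotes its specialisation $b=c$.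
   Context: $(x;q)_n=\prod_{i=0}^{n-1}(1-xq^i)$. A coloured integer $m_x$ is a positive integer $m$ (its value) with a colour $x\in\{a,c,d\}$, totally ordered by $1_a<1_c<1_d<2_a<2_c<2_d<\cdots$. Let $\mathcal{C}$ be the set of finite non-increasing (in this order, possibly empty) sequences of coloured integers such that consecutive parts $m_x$ (larger) and $m'_y$ (next) satisfy $m-m'\ge C(x,y)$, where $C(a,a)=C(a,c)=C(a,d)=2$; $C(c,a)=1,C(c,c)=1,C(c,d)=2$; $C(d,a)=0,C(d,c)=1,C(d,d)=2$. $G^C_k(q;a,c,d)=\sum_\lambda q^{|\lambda|}a^{\#_a}c^{\#_c}d^{\#_d}$ over $\lambda\in\mathcal{C}$ with all parts of value $\le k$, where $|\lambda|$ is the sum of values and $\#_x$ the number of parts of colour $x$. *)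

(* Defs.v *)
From HB Require Import structures.
From mathcomp Require Import all_boot all_order all_algebra.
From mathcomp Require Import boolp classical_sets functions cardinality fsbigop.

Set Implicit Arguments.
Unset Strict Implicit.
Unset Printing Implicit Defensive.

Import GRing.Theory.
Local Open Scope ring_scope.
Local Open Scope classical_set_scope.

Definition qpoch (F : fieldType) (x q : F) (n : nat) : F :=
  \prod_(i < n) (1 - x * q ^+ i).

Inductive colour : Type := ColA | ColC | ColD.

Definition colour_rank (x : colour) : nat :=
  match x with ColA => 0 | ColC => 1 | ColD => 2 end.

Definition colour_unrank (n : nat) : colour :=
  match n with 0 => ColA | 1 => ColC | _ => ColD end.

Lemma colour_rankK : cancel colour_rank colour_unrank.
Proof. by case. Qed.

HB.instance Definition _ := Countable.copy colour (can_type colour_rankK).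

(* The pair (m, x) is the coloured integer m_x.  Positivity of m is imposed in
   [in_C] below. *)
Definition cint : Type := (nat * colour)%type.

Definition cint_le (p p' : cint) : bool :=
  (p.1 < p'.1)%N || (p.1 == p'.1) && (colour_rank p.2 <= colour_rank p'.2)%N.

Definition min_diff (x y : colour) : nat :=
  match x, y with
  | ColA, ColA => 2 | ColA, ColC => 2 | ColA, ColD => 2
  | ColC, ColA => 1 | ColC, ColC => 1 | ColC, ColD => 2
  | ColD, ColA => 0 | ColD, ColC => 1 | ColD, ColD => 2
  end.

(* [sorted e s] says that [e p p'] holds for all consecutive p, p' in s.  The
   condition m - m' >= C(x,y) is written m' + C(x,y) <= m, since subtraction on
   nat is truncated. *)
Definition in_C (s : seq cint) : bool :=
  [&& all (fun p => 0 < p.1)%N s,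
      sorted (fun p p' => cint_le p' p) s
    & sorted (fun p p' => p'.1 + min_diff p.2 p'.2 <= p.1)%N s].

Definition C_le (k : nat) : set (seq cint) :=
  [set s | in_C s /\ all (fun p => p.1 <= k)%N s].

Definition weight (s : seq cint) : nat := (\sum_(p <- s) p.1)%N.

Definition ncol (x : colour) (s : seq cint) : nat :=
  count (fun p => p.2 == x) s.

(* The \sum over a classical set is the usual sum because [C_le k] is finite:
   see [finite_C_le]. *)
Definition GC (F : fieldType) (k : nat) (q a c d : F) : F :=
  \sum_(s \in C_le k)
    (q ^+ weight s * a ^+ ncol ColA s * c ^+ ncol ColC s * d ^+ ncol ColD s).

Lemma finite_C_le (k : nat) : finite_set (C_le k).
Proof.
pose f (p : 'I_k.+1 * 'I_3) : cint := (nat_of_ord p.1, colour_unrank p.2).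
pose A := map f (enum predT).
pose words (n : nat) := iter n (fun w => [:: [::] & [seq x :: s | x <- A, s <- w]]) [::].
have wordsP n (s : seq cint) : (size s < n)%N -> {subset s <= A} -> s \in words n.
  elim: n s => [//|n IH] [|x s] //= lt_s sub_s; rewrite inE; apply/orP; right.
  apply/allpairsP; exists (x, s); split => //=; first by apply: sub_s; exact: mem_head.
  by apply: IH => // y sy; apply: sub_s; rewrite inE sy orbT.
apply: (sub_finite_set _ (finite_seq (words (size A).+1))) => s /= [/and3P [_ s1 s2] les].
pose lt (p p' : cint) := (3 * p'.1 + colour_rank p'.2 < 3 * p.1 + colour_rank p.2)%N.
have lt_s : sorted lt s.
  have := conj s1 s2; case: s {s1 s2 les} => [//|x s] /= [].
  elim: s x => [//|y s IH] x /= /andP [le1 s1] /andP [le2 s2].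
  rewrite IH // andbT /lt; move: x y le1 le2 {IH s1 s2} => [m x] [m' y].
  rewrite /cint_le /=; case/orP => [lt_m|/andP [/eqP -> le_xy]] le2.
    have : (3 * m'.+1 <= 3 * m)%N by rewrite leq_mul2l.
    rewrite mulnS => h; apply: (leq_trans _ (leq_trans h (leq_addr _ _))).
    by rewrite addnC ltn_add2r; case: (y).
  move: le2; rewrite -[leqRHS]addn0 leq_add2l ltn_add2l.
  by case: x y {le_xy} => [] [].
have us : uniq s.
  by apply: (sorted_uniq _ _ lt_s) => [y x z h1 h2|x]; [exact: ltn_trans h2 h1|rewrite /lt ltnn].
have sub_s : {subset s <= A}.
  move=> [m x] /(allP les) /= le_m; have lt_m : (m < k.+1)%N by [].
  have lt_x : (colour_rank x < 3)%N by case: (x).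
  apply/mapP; exists (Ordinal lt_m, Ordinal lt_x); first by rewrite mem_enum.
  by rewrite /f /= colour_rankK.
have ws : s \in words (size A).+1.
  by apply: wordsP => //; rewrite ltnS; exact: uniq_leq_size.
exact: ws.
Qed.

Definition u_even (F : fieldType) (n : nat) (q a b c d : F) : F :=
  (1 - b) * \sum_(l < n.+1)
    (qpoch (- a * q ^+ (2 * l + 1)) (q ^+ 2) (n - l)
       * qpoch (- d * q ^+ (2 * l + 1)) (q ^+ 2) (n - l)
     / (qpoch (b * q ^+ (2 * l)) (q ^+ 2) (n - l + 1)
       * qpoch (c * q ^+ (2 * l + 1)) (q ^+ 2) (n - l))
     * (q ^+ (2 * l) / qpoch q q (2 * l))).

Definition u_odd (F : fieldType) (n : nat) (q a b c d : F) : F :=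
  (b - 1) * \sum_(l < n.+1)
    (qpoch (- a * q ^+ (2 * l + 2)) (q ^+ 2) (n - l)
       * qpoch (- d * q ^+ (2 * l + 2)) (q ^+ 2) (n - l)
     / (qpoch (b * q ^+ (2 * l + 1)) (q ^+ 2) (n - l + 1)
       * qpoch (c * q ^+ (2 * l + 2)) (q ^+ 2) (n - l))
     * (q ^+ (2 * l + 1) / qpoch q q (2 * l + 1))).

Definition u (F : fieldType) (j : nat) (q a b c d : F) : F :=
  if odd j then u_odd j./2 q a b c d else u_even j./2 q a b c d.

(* Main.v *)
Require Import Defs.
From mathcomp Require Import all_boot all_order all_algebra.
From mathcomp Require Import boolp classical_sets functions cardinality fsbigop.
From mathcomp Require Import ring zify.

Import GRing.Theory.
Local Open Scope ring_scope.

(* Let G_n count the sequences with parts < n and H_n those with parts at most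
   n_c.  Removing the largest part gives
     H_n = G_n + a q^n G_(n-1) + c q^n H_(n-1),
     G_(n+1) = H_n + d q^n (H_(n-1) + a q^n G_(n-1)),
   and eliminating H yields a four-term recurrence for G.  After the
   substitution G_n = (cq;q)_n f_n it says that the generating function f(t) of
   (f_n), divided by (-t;q)_oo, has coefficients u_n satisfying
     (1 - c q^n)(1 - c q^(n-1)) u_n = (1 + a q^(n-1))(1 + d q^(n-1)) u_(n-2)
                            + (1 - c)(1 - c q^(n-1)) (-q)^n / (q;q)_n,
   where the last term comes from the initial values.  Unfolding this two-step
   recurrence gives the sums defining u.  Conversely, f is recovered from u by
   convolution with the coefficients q^C(m,2) / (q;q)_m of (-t;q)_oo. *)

(** * Sequences classified by their first part *)

Definition head_in (P : pred cint) (s : seq cint) : bool :=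
  if s is p :: _ then P p else true.

(** Constraining only the first part makes the tails that may follow p a set of the same kind, with
    [can_follow p] for [P]. *)
Definition C_head (P : pred cint) : set (seq cint) :=
  [set s | in_C s /\ head_in P s]%classic.

Definition can_follow (p p' : cint) : bool :=
  cint_le p' p && (p'.1 + min_diff p.2 p'.2 <= p.1)%N.

Lemma cint_eqE (p p' : cint) :
  (p == p') = (p.1 == p'.1) && (colour_rank p.2 == colour_rank p'.2).
Proof. by rewrite (can_eq colour_rankK) -pair_eqE. Qed.

Lemma in_C_cons p s :
  in_C (p :: s) = [&& (0 < p.1)%N, head_in (can_follow p) s & in_C s].
Proof.
rewrite /in_C /can_follow; case: s => [|p' s] /=; first by rewrite !andbT.
by case: (0 < p.1)%N; case: (cint_le p' p); rewrite //= ?andbF //; do !bool_congr.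
Qed.

Lemma C_head_le k : C_head (fun p => p.1 <= k)%N = C_le k.
Proof.
apply/seteqP; split=> s /= [Cs].
  case: s Cs => [|p s] //= Cs le_p; split=> //=; rewrite le_p /=.
  elim: s p Cs le_p => [//|p' s IH] p.
  rewrite in_C_cons => /and3P[_ /= /andP[le_p' _] Cs] le_p.
  have le_p'k : (p'.1 <= k)%N.
    by apply: leq_trans le_p; case/orP: le_p' => [/ltnW //|/andP[/eqP -> _]].
  by rewrite /= le_p'k /= (IH p').
by move=> les; split=> //; case: s Cs les => //= p s _ /andP[].
Qed.

(** * Generating functions and removal of the largest part *)

Section GeneratingFunction.
Variables (F : fieldType) (q a c d : F).

Definition monomial (s : seq cint) : F :=
  q ^+ weight s * a ^+ ncol ColA s * c ^+ ncol ColC s * d ^+ ncol ColD s.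

Definition colour_weight (x : colour) : F :=
  match x with ColA => a | ColC => c | ColD => d end.

Definition gf (P : pred cint) : F := \sum_(s \in C_head P) monomial s.

Lemma monomial_cons p s : monomial (p :: s) = colour_weight p.2 * q ^+ p.1 * monomial s.
Proof.
case: p => m x; rewrite /monomial /weight big_cons /ncol /= !exprD.
by case: x; rewrite /= ?expr0 ?expr1; ring.
Qed.

Lemma eq_gf (P P' : pred cint) :
  (forall p, (0 < p.1)%N -> P p = P' p) -> gf P = gf P'.
Proof.
move=> PP'; rewrite /gf; congr (\big[_/_]_(s \in _) _).
apply/seteqP; split=> -[|p s] //= [Cs Pp]; split=> //=; move: (Cs) Pp => /=;
  by rewrite in_C_cons => /and3P[p0 _ _]; rewrite PP'.
Qed.

Lemma gf_nil (P : pred cint) : (forall p, (0 < p.1)%N -> P p = false) -> gf P = 1.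
Proof.
move=> P0; rewrite /gf.
suff -> : C_head P = [set [::]]%classic.
  by rewrite fsbig_set1 /monomial /weight big_nil /ncol /= !expr0 !mulr1.
apply/seteqP; split=> [[|p s] //= [Cs Pp]|_ -> //=].
by move: Cs Pp => /=; rewrite in_C_cons => /and3P[p0 _ _]; rewrite P0.
Qed.

Lemma finite_C_head k (P : pred cint) :
  (forall p, P p -> (p.1 <= k)%N) -> finite_set (C_head P).
Proof.
move=> Pk; apply: sub_finite_set (finite_C_le k); rewrite -C_head_le.
by move=> [|p s] //= [Cs Pp]; split=> //=; apply: Pk.
Qed.

(** The sequences gained by allowing p as first part are p followed by any sequence counted by
    [gf (can_follow p)]. The bound k supplies the finiteness that splitting the sum requires. *)
Lemma gf_add k (P P' : pred cint) (p : cint) : (0 < p.1 <= k)%N ->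
    (forall p', P p' -> (p'.1 <= k)%N) -> P p = false ->
    (forall p', P' p' = (p' == p) || P p') ->
  gf P' = gf P + colour_weight p.2 * q ^+ p.1 * gf (can_follow p).
Proof.
move=> /andP[p0 pk] Pk Pp P'E.
have fin_next : finite_set (C_head (can_follow p)).
  apply: (finite_C_head k) => p' /andP[_ h].
  by apply: leq_trans pk; apply: leq_trans h; apply: leq_addr.
rewrite {3}/gf mulr_fsumr.
under eq_fsbigr do rewrite -monomial_cons.
rewrite -(fsbig_image (C_head (can_follow p)) (cons p) monomial); last by move=> s s' _ _ [].
rewrite /gf -fsbigU0; first last.
- by move=> s /= [[_ Ps] [s' _ es]]; move: Ps; rewrite -es /= Pp.
- exact: finite_image.
- exact: (finite_C_head k).
congr (\big[_/_]_(s \in _) _); apply/seteqP; split=> [[|p' s]|s] /=.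
- by left.
- case=> Cs /=; rewrite P'E => /orP[/eqP ep|]; last by left.
  right; exists s; last by rewrite ep.
  by move: Cs; rewrite in_C_cons ep => /and3P[].
- case=> [[Cs Ps]|[s' [Cs Ps] <-]].
    by split=> //; case: s Cs Ps => //= p' s _ Pp'; rewrite P'E Pp' orbT.
  by split; rewrite ?in_C_cons /= ?P'E ?eqxx // p0 Ps.
Qed.

Definition gf_lt (n : nat) : F := gf (fun p => p.1 < n)%N.

(** These are exactly the parts allowed after (n+1)_c. *)
Definition up_to_c (n : nat) (p : cint) : bool :=
  (p.1 < n)%N || (p.1 == n) && (colour_rank p.2 < 2)%N.

Lemma GC_gf k : GC k q a c d = gf_lt k.+1.
Proof. by rewrite /GC -C_head_le. Qed.

Lemma gf_lt0 : gf_lt 0 = 1.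
Proof. exact: gf_nil. Qed.

Lemma gf_lt1 : gf_lt 1 = 1.
Proof. by apply: gf_nil => p; lia. Qed.

Lemma gf_up_to_c0 : gf (up_to_c 0) = 1.
Proof. by apply: gf_nil => -[m x] /=; rewrite /up_to_c /=; lia. Qed.

Lemma gf_follow_a n : gf (can_follow (n.+1, ColA)) = gf_lt n.
Proof.
by apply: eq_gf => -[m x]; rewrite /can_follow /cint_le; case: x => /=; lia.
Qed.

Lemma gf_follow_c n : gf (can_follow (n.+1, ColC)) = gf (up_to_c n).
Proof.
by apply: eq_gf => -[m x]; rewrite /can_follow /cint_le /up_to_c; case: x => /=; lia.
Qed.

(** Since C(d,a) = 0, the part (n+1)_a may follow (n+1)_d, in addition to the parts up to n_c. *)
Lemma gf_follow_d n :
  gf (can_follow (n.+1, ColD)) = gf (up_to_c n) + a * q ^+ n.+1 * gf_lt n.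
Proof.
rewrite -gf_follow_a; apply: (gf_add n.+1 _ _ (n.+1, ColA)) => //=.
- by case=> m x; rewrite /up_to_c /=; lia.
- by rewrite /up_to_c /=; lia.
- by case=> m x; rewrite /can_follow /cint_le /up_to_c cint_eqE; case: x => /=; lia.
Qed.

Lemma gf_up_to_cS n :
  gf (up_to_c n.+1) = gf_lt n.+1 + a * q ^+ n.+1 * gf_lt n
                      + c * q ^+ n.+1 * gf (up_to_c n).
Proof.
rewrite -(gf_follow_a n) -(gf_follow_c n).
pose up_to_a (p : cint) := (p == (n.+1, ColA)) || (p.1 < n.+1)%N.
have <- : gf up_to_a = gf_lt n.+1 + a * q ^+ n.+1 * gf (can_follow (n.+1, ColA)).
  by apply: (gf_add n.+1 _ _ (n.+1, ColA)) => //=; lia.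
apply: (gf_add n.+1 _ _ (n.+1, ColC)) => //=.
- by case=> m x; rewrite /up_to_a cint_eqE /=; lia.
- by rewrite /up_to_a cint_eqE /=; lia.
- by case=> m x; rewrite /up_to_c /up_to_a !cint_eqE; case: x => /=; lia.
Qed.

Lemma gf_ltSS n :
  gf_lt n.+2 = gf (up_to_c n.+1)
               + d * q ^+ n.+1 * (gf (up_to_c n) + a * q ^+ n.+1 * gf_lt n).
Proof.
rewrite -gf_follow_d; apply: (gf_add n.+1 _ _ (n.+1, ColD)) => //=.
- by case=> m x; rewrite /up_to_c /=; lia.
- by rewrite /up_to_c /=; lia.
- by case=> m x; rewrite /up_to_c !cint_eqE; case: x => /=; lia.
Qed.

Lemma gf_lt_rec n :
  gf_lt n.+2 = (1 + c * q ^+ n.+1) * gf_lt n.+1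
    + q ^+ n.+1 * (a + d + a * d * q ^+ n.+1) * gf_lt n
    + a * d * q ^+ (2 * n + 1) * (1 - c * q ^+ n) * (if n is m.+1 then gf_lt m else 0).
Proof.
case: n => [|n]; first by rewrite gf_ltSS gf_up_to_cS gf_up_to_c0 gf_lt0 gf_lt1; ring.
have eH := gf_up_to_cS n; have eG := gf_ltSS n.
rewrite gf_ltSS gf_up_to_cS.
have e2n : q ^+ (2 * n.+1 + 1) = q * q ^+ n.+1 * q ^+ n.+1.
  by rewrite addn1 mul2n -addnn exprS exprD mulrA.
rewrite e2n (exprS q n.+1); set X := q ^+ n.+1 in eH eG *.
set h1 := gf (up_to_c n.+1) in eH eG *; set h0 := gf (up_to_c n) in eH eG *.
(* In this combination [h0] cancels; the next step involves [h1] only through (c + d) h1, so nothing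
   is divided by c + d. *)
have eh : (c + d) * h1 = c * (gf_lt n.+2 - a * d * X * X * gf_lt n)
                         + d * (gf_lt n.+1 + a * X * gf_lt n).
  by rewrite eG eH; ring.
have -> : gf_lt n.+2 + a * (q * X) * gf_lt n.+1 + c * (q * X) * h1
   + d * (q * X) * (h1 + a * (q * X) * gf_lt n.+1)
  = gf_lt n.+2 + a * (q * X) * gf_lt n.+1 + a * d * (q * X) * (q * X) * gf_lt n.+1
    + q * X * ((c + d) * h1) by ring.
by rewrite eh; ring.
Qed.

End GeneratingFunction.

(** * Products of power series, coefficient by coefficient *)

Section Convolution.
Variable F : comNzRingType.
Implicit Types (x y : nat -> F) (r : F) (n : nat).

(** Sequences are coefficients of power series in t: [conv] is the product, [dilate q] substitutes
    qt for t, [shift] multiplies by t. *)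
Definition conv x y n : F := \sum_(i < n.+1) x i * y (n - i)%N.
Definition dilate q x n : F := q ^+ n * x n.
Definition shift x n : F := if n is m.+1 then x m else 0.

Lemma convC x y n : conv x y n = conv y x n.
Proof.
rewrite /conv (reindex_inj rev_ord_inj) /=; apply: eq_bigr => i _.
by rewrite subSS subKn ?leq_ord // mulrC.
Qed.

Lemma eq_convl x x' y n :
  (forall i, (i <= n)%N -> x i = x' i) -> conv x y n = conv x' y n.
Proof. by move=> e; apply: eq_bigr => i _; rewrite e ?leq_ord. Qed.

Lemma convDl x x' y n : conv (fun i => x i + x' i) y n = conv x y n + conv x' y n.
Proof. by rewrite -big_split; apply: eq_bigr => i _; rewrite mulrDl. Qed.

Lemma convZl r x y n : conv (fun i => r * x i) y n = r * conv x y n.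
Proof. by rewrite /conv mulr_sumr; apply: eq_bigr => i _; rewrite mulrA. Qed.

Lemma conv_shiftl x y n : conv (shift x) y n = shift (conv x y) n.
Proof.
case: n => [|n]; first by rewrite /conv big_ord1 mul0r.
by rewrite /conv big_ord_recl mul0r add0r.
Qed.

Lemma conv_dilate q x y n :
  conv (dilate q x) (dilate q y) n = q ^+ n * conv x y n.
Proof.
rewrite /conv mulr_sumr; apply: eq_bigr => i _.
by rewrite mulrACA -exprD subnKC // leq_ord.
Qed.

(** A factor 1 + rt of x(t) passes to the product; coefficients up to n suffice. *)
Lemma conv_addshiftl r x x' y n :
    (forall i, (i <= n)%N -> x i = x' i + r * shift x' i) ->
  conv x y n = conv x' y n + r * shift (conv x' y) n.
Proof. by move=> e; rewrite (eq_convl _ _ _ _ e) convDl convZl conv_shiftl. Qed.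

Lemma conv_addshiftr r x y y' n :
    (forall i, (i <= n)%N -> y i = y' i + r * shift y' i) ->
  conv x y n = conv x y' n + r * shift (conv x y') n.
Proof.
move=> e; rewrite convC (conv_addshiftl _ _ _ _ _ e) convC.
by congr (_ + _ * _); case: n {e} => //= n; rewrite convC.
Qed.

End Convolution.

Arguments conv {F}.
Arguments dilate {F}.
Arguments shift {F}.

(** * The two-step recurrence of [u] at b = c *)

Lemma qpochS (F : fieldType) (x q : F) n :
  qpoch x q n.+1 = qpoch x q n * (1 - x * q ^+ n).
Proof. by rewrite /qpoch big_ord_recr. Qed.

Lemma qpoch0 (F : fieldType) (x q : F) : qpoch x q 0 = 1.
Proof. by rewrite /qpoch big_ord0. Qed.

Section URecurrence.
Variables (F : fieldType) (q a c d : F).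

(* [s] is the parity of the index of u. *)
Definition u_sum (s n : nat) : F :=
  \sum_(l < n.+1)
    (qpoch (- a * q ^+ (2 * l + s).+1) (q ^+ 2) (n - l)
       * qpoch (- d * q ^+ (2 * l + s).+1) (q ^+ 2) (n - l)
     / (qpoch (c * q ^+ (2 * l + s)) (q ^+ 2) (n - l + 1)
       * qpoch (c * q ^+ (2 * l + s).+1) (q ^+ 2) (n - l))
     * (q ^+ (2 * l + s) / qpoch q q (2 * l + s))).

Lemma u_double n : u n.*2 q a c c d = (1 - c) * u_sum 0 n.
Proof.
rewrite /u odd_double doubleK /u_even; congr (_ * _).
by apply: eq_bigr => l _; rewrite !addn0 !addn1.
Qed.

Lemma u_doubleS n : u n.*2.+1 q a c c d = (c - 1) * u_sum 1 n.
Proof.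
rewrite /u /= odd_double /= uphalf_double /u_odd; congr (_ * _).
by apply: eq_bigr => l _; rewrite !addn1 !addn2.
Qed.

(** When n grows by one, each term l <= n gains one last factor in each of its four products indexed
    by n - l; the new term l = n+1 is the inhomogeneous part. *)
Lemma u_sum_rec s n (m := (2 * n + s)%N) :
    c * q ^+ m.+1 != 1 -> c * q ^+ m.+2 != 1 ->
  (1 - c * q ^+ m.+2) * (1 - c * q ^+ m.+1) * u_sum s n.+1 =
    (1 + a * q ^+ m.+1) * (1 + d * q ^+ m.+1) * u_sum s n
    + (1 - c * q ^+ m.+1) * q ^+ m.+2 / qpoch q q m.+2.
Proof.
rewrite eq_sym -subr_eq0 => c1; rewrite eq_sym -subr_eq0 => c2.
have em : (2 * n.+1 + s)%N = m.+2 by rewrite mulnS.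
rewrite {1}/u_sum big_ord_recr mulrDr; congr (_ + _); last first.
  have -> : nat_of_ord (@ord_max n.+1) = n.+1 by [].
  rewrite subnn em add0n; set z := (qpoch q q m.+2)^-1.
  by rewrite qpochS !qpoch0 expr0 !mul1r !mulr1; field.
rewrite /u_sum !mulr_sumr; apply: eq_bigr => l _.
have -> : (n.+1 - l = (n - l).+1)%N by rewrite subSn // leq_ord.
rewrite addSn (addn1 (n - l)) !qpochS -!exprM -!mulrA -!exprD.
have -> : ((2 * l + s).+1 + 2 * (n - l) = m.+1)%N by have := leq_ord l; lia.
have -> : ((2 * l + s) + 2 * (n - l).+1 = m.+2)%N by have := leq_ord l; lia.
rewrite !mulNr !opprK !invfM.
rewrite -[nat_of_ord (widen_ord _ _)]/(nat_of_ord l).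
(* With these inverses as atoms, [field] needs only 1 - c q^(m+1) and 1 - c q^(m+2) to be
   nonzero. *)
move: (qpoch q q _)^-1 (qpoch (c * q ^+ (2 * l + s)) _ _)^-1
  (qpoch (c * q ^+ (2 * l + s).+1) _ _)^-1
  (1 - c * q ^+ (2 * l + s + 2 * (n - l)))^-1 => z x y w.
by field; rewrite c1 c2.
Qed.

Lemma u_sum0 s : c * q ^+ s != 1 ->
  (1 - c * q ^+ s) * u_sum s 0 = q ^+ s / qpoch q q s.
Proof.
rewrite eq_sym -subr_eq0 => cs; rewrite /u_sum big_ord1 /= !qpochS !qpoch0 expr0.
by move: (qpoch q q s)^-1 => z; field.
Qed.

Lemma u0 : c != 1 -> u 0 q a c c d = 1.
Proof.
by move=> c1; have := u_sum0 0; rewrite (u_double 0) expr0 mulr1 qpoch0 divr1; apply.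
Qed.

Lemma u1 : c * q != 1 -> (1 - c * q) * u 1 q a c c d = (c - 1) * (q / (1 - q)).
Proof.
move=> c1; have := u_sum0 1.
rewrite (u_doubleS 0) expr1 qpochS qpoch0 expr0 mulr1 mul1r => e.
by rewrite mulrCA e.
Qed.

(** Both parities at once: with m = 2n + b, [u] is (-1)^b (1 - c) [u_sum b n]. *)
Lemma u_rec m :
    c * q ^+ m.+1 != 1 -> c * q ^+ m.+2 != 1 ->
  (1 - c * q ^+ m.+2) * (1 - c * q ^+ m.+1) * u m.+2 q a c c d =
    (1 + a * q ^+ m.+1) * (1 + d * q ^+ m.+1) * u m q a c c d
    + (1 - c) * (1 - c * q ^+ m.+1) * ((- q) ^+ m.+2 / qpoch q q m.+2).
Proof.
have -> : m = (2 * m./2 + odd m)%N by rewrite mul2n addnC odd_double_half.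
move: m./2 (odd m) => n b c1 c2; have := u_sum_rec b n c1 c2.
rewrite exprNn -signr_odd.
have -> : odd (2 * n + b).+2 = b by rewrite /= negbK oddD mul2n odd_double; case: (b).
have -> : u (2 * n + b).+2 q a c c d = (-1) ^+ b * (1 - c) * u_sum b n.+1.
  case: b {c1 c2}; last by rewrite mul2n addn0 -doubleS u_double mul1r.
  by rewrite mul2n addn1 -doubleS u_doubleS mulN1r opprB.
have -> : u (2 * n + b) q a c c d = (-1) ^+ b * (1 - c) * u_sum b n.
  case: b {c1 c2}; last by rewrite mul2n addn0 u_double mul1r.
  by rewrite mul2n addn1 u_doubleS mulN1r opprB.
by move=> rec; rewrite [LHS]mulrCA rec; ring.
Qed.

End URecurrence.

(** * From the recurrence of [u] to that of the convolution sum *)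

Section SumRecurrence.
Variables (F : fieldType) (q a c d : F) (K : nat).
Hypothesis q_neq : forall i : nat, (1 <= i <= K)%N -> q ^+ i != 1.
Hypothesis cq_neq : forall i : nat, (i <= K)%N -> c * q ^+ i != 1.

Let U j : F := u j q a c c d.
Let D := dilate q.

Definition euler m : F := q ^+ 'C(m, 2) / qpoch q q m.

Definition euler_inv m : F := (- q) ^+ m / qpoch q q m.

Definition usum : nat -> F := conv U euler.

(** Coefficients of (-t;q)_oo, (-tq;q)_oo and (-tq^2;q)_oo, so that e0(t) = (1 + t) e1(t) and e1(t)
    = (1 + qt) e2(t). *)
Let e0 := euler.
Let e1 := D e0.
Let e2 := D e1.
Let v := euler_inv.

Lemma q_unit m : (m < K)%N -> 1 - q * q ^+ m != 0.
Proof. by move=> mK; rewrite subr_eq0 eq_sym -exprS q_neq // mK. Qed.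

Lemma qpochS_inv m (x : F) : (m < K)%N ->
  (1 - q * q ^+ m) * (x / qpoch q q m.+1) = x / qpoch q q m.
Proof.
move=> /q_unit mK; rewrite qpochS; move: mK; set r := 1 - _ => r0.
by rewrite invfM; move: (qpoch q q m)^-1 => z; field.
Qed.

Lemma euler0 : euler 0 = 1.
Proof. by rewrite /euler qpoch0 divr1. Qed.

Lemma euler1 : euler 1 = (1 - q)^-1.
Proof. by rewrite /euler qpochS qpoch0 expr0 mulr1 !mul1r. Qed.

Lemma eulerS m : (m < K)%N -> euler m.+1 = D euler m.+1 + q ^+ m * euler m.
Proof.
move=> mK; rewrite /D /dilate /euler.
rewrite -(qpochS_inv _ (q ^+ 'C(m, 2))) // binS bin1 exprD.
by move: (qpoch q q _)^-1 => z; rewrite exprS; ring.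
Qed.

Lemma euler_invS m : (m < K)%N ->
  D euler_inv m.+1 = euler_inv m.+1 + q * euler_inv m.
Proof.
move=> mK; rewrite /D /dilate /euler_inv -(qpochS_inv _ ((- q) ^+ m)) //.
by rewrite !exprS; ring.
Qed.

Lemma e0_split i : (i <= K)%N -> e0 i = e1 i + 1 * shift e1 i.
Proof.
case: i => [|m] mK; first by rewrite /e1 /D /dilate /= expr0; ring.
by rewrite /e0 eulerS // mul1r.
Qed.

Lemma e1_split i : (i <= K)%N -> e1 i = e2 i + q * shift e2 i.
Proof.
case: i => [|m] mK; first by rewrite /e2 /D /dilate /= expr0; ring.
have := eulerS _ mK; rewrite /e2 /e1 /e0 /D /dilate /= => E.
by rewrite [X in _ * X = _]E exprS; ring.
Qed.

Lemma v_split i : (i <= K)%N -> D v i = v i + q * shift v i.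
Proof.
case: i => [|m] mK; first by rewrite /D /dilate /= expr0; ring.
exact: euler_invS.
Qed.

(* The generating functions of [v] and [e1] are 1/(-tq;q)_oo and (-tq;q)_oo. *)
Lemma conv_v_e1 n : (0 < n <= K)%N -> conv v e1 n = 0.
Proof.
move=> /andP[n0 nK].
(* Substituting qt for t moves the factor 1 + qt from [e1] to [v], so the product is unchanged; as
   q^n != 1, its coefficient vanishes. *)
have : q ^+ n * conv v e1 n = conv v e1 n.
  rewrite -conv_dilate (conv_addshiftl F q _ v) => [|i iK]; last first.
    by apply: v_split; apply: leq_trans nK.
  by rewrite -(conv_addshiftr F q v e1 e2) // => i iK; apply: e1_split; apply: leq_trans nK.
move/eqP; rewrite -subr_eq0 -{2}[conv _ _ _]mul1r -mulrBl mulf_eq0 subr_eq0.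
by rewrite (negbTE (q_neq _ _)) ?n0 // => /eqP.
Qed.

(** The product is v(qt) e1(t) = 1 + qt. *)
Lemma conv_Dv_e1 n : (1 < n <= K)%N -> conv (D v) e1 n = 0.
Proof.
case: n => // n /andP[n1 nK]; rewrite (conv_addshiftl F q _ v) => [|i iK]; last first.
  by apply: v_split; apply: leq_trans nK.
by rewrite /= !conv_v_e1 ?mulr0 ?addr0 //; lia.
Qed.

(* [w] is q times the defect of the two-step recurrence for u, including its
   boundary terms; the factor q avoids q^-1 at index 0. *)
Let X i := (1 + a * q * q ^+ i) * (1 + d * q * q ^+ i) * U i.
Let w j := (1 - c * q ^+ j) * (q - c * q ^+ j) * U j - q * shift (shift X) j.

(** The inhomogeneous term times q contains q (1 - c q^(j-1)) v_j = q v_j - c q^j v_j. At j = 0 and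
    1 the initial values of [u] give the same formula. *)
Lemma wE j : (j <= K)%N -> w j = (1 - c) * (q * v j - c * D v j).
Proof.
rewrite /w /D /dilate /v /euler_inv; case: j => [|[|m]] mK /=.
- by rewrite qpoch0 /U u0 ?divr1 ?expr0; [ring|have := cq_neq 0 mK; rewrite mulr1].
- have c1 := cq_neq 1 mK; rewrite expr1 in c1.
  rewrite !expr1 qpochS qpoch0 expr0 mul1r mulr1.
  have -> : (1 - c * q) * (q - c * q) * U 1 - q * 0
            = (q - c * q) * ((1 - c * q) * U 1) by ring.
  by rewrite u1 //; move: (1 - q)^-1 => z; ring.
have rec := u_rec F q a c d m (cq_neq _ (ltnW mK)) (cq_neq _ mK).
have -> : (1 - c * q ^+ m.+2) * (q - c * q ^+ m.+2) * U m.+2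
  = q * ((1 - c * q ^+ m.+2) * (1 - c * q ^+ m.+1) * U m.+2) by rewrite !exprS; ring.
rewrite rec /X -/(U m); move: (_ / _) => z; rewrite !exprS; ring.
Qed.

Lemma conv_w_e1 n : (1 < n <= K)%N -> conv w e1 n = 0.
Proof.
move=> /andP[n1 nK].
rewrite (eq_convl F _ (fun j => ((1 - c) * q) * v j + (- (1 - c) * c) * D v j)); last first.
  by move=> i iK; rewrite wE ?(leq_trans iK) //; ring.
by rewrite convDl !convZl conv_v_e1 ?conv_Dv_e1 ?mulr0 ?addr0 //; lia.
Qed.

(** With S(t) the series of [usum], the common factor [e2] gives S(t) = (1 + t)(1 + qt) G0(t), S(qt)
    = (1 + qt) G1(t) and S(q^2 t) = G2(t). *)
Let G0 := conv U e2.
Let G1 := conv (D U) e2.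
Let G2 := conv (D (D U)) e2.

Lemma conv_w_e2 n :
  conv w e2 n = q * G0 n - c * (1 + q) * G1 n + c ^+ 2 * G2 n
    - q * shift (shift (fun i => G0 i + (a + d) * q * G1 i + a * d * q ^+ 2 * G2 i)) n.
Proof.
rewrite (eq_convl F _ (fun j => q * U j + ((- c * (1 + q)) * D U j
    + (c ^+ 2 * D (D U) j + (- q) * shift (shift X) j)))); last first.
  by move=> i _; rewrite /w /D /dilate; ring.
rewrite !convDl !convZl conv_shiftl -/G0 -/G1 -/G2.
suff -> : shift (conv (shift X) e2) n = shift (shift
  (fun i => G0 i + (a + d) * q * G1 i + a * d * q ^+ 2 * G2 i)) n by ring.
case: n => //= n; rewrite conv_shiftl; case: n => //= n.
rewrite (eq_convl F _ (fun j => U j + (((a + d) * q) * D U j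
    + (a * d * q ^+ 2) * D (D U) j))).
  by rewrite !convDl !convZl addrA.
by move=> i _; rewrite /X /D /dilate; ring.
Qed.

Lemma usumE n : (n <= K)%N ->
  usum n = G0 n + (1 + q) * shift G0 n + q * shift (shift G0) n.
Proof.
move=> nK; rewrite /usum (conv_addshiftr F 1 _ _ e1); last first.
  by move=> i iK; apply: e0_split; apply: leq_trans nK.
have h m : (m <= K)%N -> conv U e1 m = G0 m + q * shift G0 m.
  by move=> mK; apply: conv_addshiftr => i iK; apply: e1_split; apply: leq_trans mK.
rewrite h //; case: n nK => [|n] nK /=; first by ring.
by rewrite h ?(ltnW nK) //; ring.
Qed.

Lemma q_usumE n : (n <= K)%N -> q ^+ n * usum n = G1 n + q * shift G1 n.
Proof.
move=> nK; rewrite -conv_dilate; apply: conv_addshiftr => i iK.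
by apply: e1_split; apply: leq_trans nK.
Qed.

Lemma qq_usumE n : q ^+ n * (q ^+ n * usum n) = G2 n.
Proof. by rewrite -!conv_dilate. Qed.

Lemma usum_rec_scaled m : (m.+2 <= K)%N ->
  q * ((1 - c * q ^+ m.+2) * (1 - c * q ^+ m.+1) * usum m.+2)
  = q * ((1 - c ^+ 2 * q ^+ (2 * m + 2)) * usum m.+1
         + q ^+ m.+1 * (a + d + a * d * q ^+ m.+1) * usum m
         + a * d * q ^+ (2 * m + 1) * shift usum m).
Proof.
move=> mK.
(* The vanishing coefficient of t^(m+2) in w(t) e1(t) = (1 + qt) w(t) e2(t) is linear in [G0], [G1],
   [G2]. *)
have := conv_w_e1 m.+2 mK; rewrite (conv_addshiftr F q _ _ e2); last first.
  by move=> i iK; apply: e1_split; apply: leq_trans mK.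
rewrite /= !conv_w_e2 /=.
have mK1 := ltnW mK; have mK0 := ltnW mK1.
have E2 := usumE _ mK; have E1 := usumE _ mK1; rewrite /= in E1 E2.
have A2 := q_usumE _ mK; have A0 := q_usumE _ mK0; rewrite /= in A2.
have B2 := qq_usumE m.+2; have B1 := qq_usumE m.+1; have B0 := qq_usumE m.
have Bm : q ^+ m * (q ^+ m * shift usum m) = q ^+ 2 * shift G2 m.
  by case: (m) => [|i] /=; [ring|rewrite -qq_usumE !exprS; ring].
have -> : shift (fun i => G0 i + (a + d) * q * G1 i + a * d * q ^+ 2 * G2 i) m
  = shift G0 m + (a + d) * q * shift G1 m + a * d * q ^+ 2 * shift G2 m.
  by case: (m) => [|i] /=; ring.
move=> W; apply/eqP; rewrite -subr_eq0; apply/eqP; rewrite -[RHS]W.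
have e2m : q ^+ (2 * m) = q ^+ m * q ^+ m by rewrite mul2n -addnn exprD.
(* Solving for these values of [G0] and [G1] brings in [usum]; the other values of [G0] and [G1]
   cancel. *)
have E2' : G0 m.+2 = usum m.+2 - (1 + q) * G0 m.+1 - q * G0 m by rewrite E2; ring.
have E1' : G0 m.+1 = usum m.+1 - (1 + q) * G0 m - q * shift G0 m by rewrite E1; ring.
have A2' : G1 m.+2 = q ^+ m.+2 * usum m.+2 - q * G1 m.+1 by rewrite A2; ring.
have A0' : G1 m = q ^+ m * usum m - q * shift G1 m by rewrite A0; ring.
rewrite -(mulrA (a * d) (q ^+ 2) (shift G2 m)) -Bm.
rewrite A2' A0' E2' E1' -B2 -B1 -B0 (exprD q (2 * m) 2) (exprD q (2 * m) 1)
  e2m !exprS !expr0.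
by ring.
Qed.

(* The factor q left over by [usum_rec_scaled] cannot be cancelled at q = 0. *)
Lemma usum_rec m : (m.+2 <= K)%N ->
  (1 - c * q ^+ m.+2) * (1 - c * q ^+ m.+1) * usum m.+2
  = (1 - c ^+ 2 * q ^+ (2 * m + 2)) * usum m.+1
    + q ^+ m.+1 * (a + d + a * d * q ^+ m.+1) * usum m
    + a * d * q ^+ (2 * m + 1) * shift usum m.
Proof.
move=> mK; have [q0|qn0] := eqVneq q 0; last first.
  by apply: (mulfI qn0); exact: usum_rec_scaled.
(* At q = 0, [U] has period 2 and [euler] vanishes from index 2 on, so both sides are sums of two
   consecutive [U]. *)
have qS i : q ^+ i.+1 = 0 by rewrite q0 expr0n.
have U_rec i : (i.+2 <= K)%N -> U i.+2 = U i.
  move=> iK; have := u_rec F q a c d i (cq_neq _ (ltnW iK)) (cq_neq _ iK).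
  by rewrite exprNn !qS !(mulr0, mul0r, subr0, addr0, mul1r).
have eulerSS i : euler i.+2 = 0.
  by rewrite /euler binS bin1 addnS qS mul0r.
have usumS i : (i.+1 <= K)%N -> usum i.+1 = U i.+1 + U i.
  move=> iK; rewrite /usum /conv !big_ord_recr /= big1 => [|j _].
    by rewrite subnn subSn // subnn euler0 euler1 q0 subr0 invr1 !mulr1 add0r addrC.
  have -> : (i.+1 - j = (i - j.+1).+2)%N by have := ltn_ord j; lia.
  by rewrite eulerSS mulr0.
rewrite addn2 addn1 !qS !usumS ?U_rec ?(ltnW mK) //.
by ring.
Qed.

Lemma usum0 : usum 0 = 1.
Proof.
rewrite /usum /conv big_ord1 subnn euler0 mulr1 /U u0 //.
by have := cq_neq 0 (leq0n K); rewrite mulr1.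
Qed.

Lemma usum1 : (0 < K)%N -> (1 - c * q) * usum 1 = 1.
Proof.
move=> K0; have c0 : c != 1 by have := cq_neq 0 (leq0n K); rewrite mulr1.
have c1 : c * q != 1 by have := cq_neq 1 K0; rewrite expr1.
rewrite /usum /conv !big_ord_recr big_ord0 /= add0r subn0 subnn /U u0 //.
rewrite euler0 euler1 mul1r mulr1 mulrDr u1 //.
have := q_unit 0 K0; rewrite expr0 mulr1 => q1.
by field.
Qed.

(** Both sides satisfy the recurrence [gf_lt_rec] with the same initial values. *)
Lemma gf_lt_usum n : (n <= K)%N -> gf_lt F q a c d n = qpoch (c * q) q n * usum n.
Proof.
elim/ltn_ind: n => -[|[|m]] IH nK.
- by rewrite gf_lt0 qpoch0 usum0 mulr1.
- by rewrite gf_lt1 qpochS qpoch0 expr0 mulr1 mul1r usum1.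
rewrite gf_lt_rec IH ?(ltnW nK) // IH ?(ltnW (ltnW nK)) //.
(* The factor 1 - c q^m completes (cq;q)_(m-1) to (cq;q)_m; at m = 0 both sides are 0. *)
have e : (1 - c * q ^+ m) * (if m is i.+1 then gf_lt F q a c d i else 0)
         = qpoch (c * q) q m * shift usum m.
  case: m nK IH => [|m] nK IH; first by rewrite !mulr0.
  by rewrite /= IH; [rewrite qpochS exprS; ring|lia|lia].
rewrite -(mulrA (a * d * q ^+ (2 * m + 1))) e !qpochS.
have -> : qpoch (c * q) q m * (1 - c * q * q ^+ m) * (1 - c * q * q ^+ m.+1) * usum m.+2
  = qpoch (c * q) q m * ((1 - c * q ^+ m.+2) * (1 - c * q ^+ m.+1) * usum m.+2).
  by rewrite !exprS; ring.
rewrite usum_rec // (exprD q (2 * m) 2) (exprD q (2 * m) 1) (mul2n m)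
  -addnn !exprD !exprS expr0.
by ring.
Qed.

End SumRecurrence.

(* The identity of rational functions in q, a, c, d, at every point of every
   field where no denominator vanishes; the factors occurring in denominators
   are 1 - q^i (1 <= i <= k+1) and 1 - c q^i (0 <= i <= k+1). *)
Theorem theorem1p12 (F : fieldType) (k : nat) (q a c d : F)
  (k_gt0 : (0 < k)%N)
  (q_neq : forall i : nat, (1 <= i <= k.+1)%N -> q ^+ i != 1)
  (cq_neq : forall i : nat, (i <= k.+1)%N -> c * q ^+ i != 1) :
  GC k q a c d =
    qpoch (c * q) q k.+1
      * \sum_(j < k.+2)
          (u j q a c c d * q ^+ 'C(k.+1 - j, 2) / qpoch q q (k.+1 - j)).
Proof.
rewrite GC_gf (gf_lt_usum _ _ _ _ _ k.+1) //; congr (_ * _).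
by apply: eq_bigr => j _; rewrite /euler mulrA.
Qed.
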